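(* Let $p\ge2$ be an integer, $r\in\{0,\dots,p-1\}$, $f=\sum_{i=0}^da_ix^i\in\mathbb{Z}_p[x]$ (with the convention $0^0:=1$), regarded as a function $\mathbb{Z}_p\to\mathbb{Z}_p$, and $k\ge0$ an integer. Then: (1) $f$ is weakly $(p,r)$-suitable at $k$. (2) If $k\le1$, then $f$ is $(p,r)$-suitable at $k$. (3) If $k\ge2$, then $f$ is $(p,r)$-suitable at $k$ if and only if $\gcd(p,f'(r)\,\%\,p)=1$, where $f'(r)\,\%\,p=\left(\sum_{i=1}^d(a_i\%p)\,i\,r^{i-1}\right)\%\,p$. In particular, if $k\ge 2$ and $a_0,a_2,\dots,a_d$ are given, then the set of all $a_1\in\mathbb{Z}_p$ that make $f$ $(p,r)$-suitable at $k$ is $$\left\{\left(a-\sum_{i=2}^d(a_i\%p)\,i\,r^{i-1}\right)\%\,p\ \middle|\ a\in\{0,\dots,p-1\},\ \gcd(p,a)=1\right\}+p\mathbb{Z}_p.$$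
   Context: $p\ge2$ is an integer, not necessarily prime. $\mathbb{Z}_p=\varprojlim \mathbb{Z}/p^k\mathbb{Z}$; every $a\in\mathbb{Z}_p$ is uniquely $a=\sum_{i\ge0}a_ip^i$ with $a_i\in\{0,\dots,p-1\}$, and $a\,\%\,p:=a_0$ (for integers, the usual remainder in $\{0,\dots,p-1\}$). A function $f:\mathbb{Z}_p\to\mathbb{Z}_p$ is weakly $(p,r)$-suitable at $k$ if for all $m,n\in r+p\mathbb{Z}_p$: $m\equiv n\pmod{p^k}$ implies $f(m)-(f(m)\%p)\equiv f(n)-(f(n)\%p)\pmod{p^k}$; it is $(p,r)$-suitable at $k$ if this implication is an equivalence for all $m,n\in r+p\mathbb{Z}_p$. $f'$ denotes the formal derivative. *)

(* Defs.v *)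
From HB Require Import structures.
From mathcomp Require Import all_boot all_order all_algebra.
From mathcomp Require Import boolp classical_sets.

Set Implicit Arguments.
Unset Strict Implicit.
Unset Printing Implicit Defensive.

Import GRing.Theory.
Local Open Scope ring_scope.

(* The inverse limit of the rings Z/p^kZ, for p >= 2 not necessarily prime.   *)
(* [approx x k] is the canonical representative in {0, ..., p^k - 1} of the   *)
(* image of x in Z/p^kZ; the bound follows from the compatibility condition.  *)
(* The proof of 1 < p is a parameter of the type because for p <= 1 the limit *)
(* is not a nontrivial ring.                                                  *)
Record padic (p : nat) (hp : (1 < p)%N) := Padic {
  approx : nat -> nat;
  approxP : forall k, approx k = (approx k.+1 %% p ^ k)%N
}.

Section PadicRing.
Variables (p : nat) (hp : (1 < p)%N).
Local Notation Zp := (padic hp).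
Implicit Types x y z : Zp.

Lemma padic_ext x y : (forall k, approx x k = approx y k) -> x = y.
Proof.
case: x y => [x hx] [y hy] /= /funext exy; case: y / exy hy => hy.
by congr Padic; exact: Prop_irrelevance.
Qed.

Lemma approx_mod x k : (approx x k %% p ^ k)%N = approx x k.
Proof. by rewrite approxP modn_mod. Qed.

Lemma expp_gt0 k : (0 < p ^ k)%N.
Proof. by rewrite expn_gt0 (ltnW hp). Qed.

Lemma approx_lt x k : (approx x k < p ^ k)%N.
Proof. by rewrite -approx_mod ltn_mod expp_gt0. Qed.

Lemma modn_expS m k : (m %% p ^ k.+1 %% p ^ k = m %% p ^ k)%N.
Proof. by rewrite modn_dvdm // expnS dvdn_mull. Qed.

Fact nat_subproof n k : (n %% p ^ k = n %% p ^ k.+1 %% p ^ k)%N.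
Proof. by rewrite modn_expS. Qed.

Fact add_subproof x y k :
  ((approx x k + approx y k) %% p ^ k =
   (approx x k.+1 + approx y k.+1) %% p ^ k.+1 %% p ^ k)%N.
Proof. by rewrite modn_expS !(approxP _ k) modnDm. Qed.

Fact mul_subproof x y k :
  ((approx x k * approx y k) %% p ^ k =
   (approx x k.+1 * approx y k.+1) %% p ^ k.+1 %% p ^ k)%N.
Proof. by rewrite modn_expS !(approxP _ k) modnMm. Qed.

Fact opp_subproof x k :
  ((p ^ k - approx x k) %% p ^ k =
   (p ^ k.+1 - approx x k.+1) %% p ^ k.+1 %% p ^ k)%N.
Proof.
rewrite modn_expS; apply/eqP.
rewrite -(eqn_modDr (approx x k)) subnK; last exact: ltnW (approx_lt x k).
rewrite [in X in _ == X](approxP x k) modnDmr subnK; last first.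
  exact: ltnW (approx_lt x k.+1).
by rewrite expnS modnn modnMl.
Qed.

Definition padic_nat n : Zp := Padic hp (nat_subproof n).
Definition padic_add x y : Zp := Padic hp (add_subproof x y).
Definition padic_mul x y : Zp := Padic hp (mul_subproof x y).
Definition padic_opp x : Zp := Padic hp (opp_subproof x).

HB.instance Definition _ := gen_eqMixin Zp.
HB.instance Definition _ := gen_choiceMixin Zp.

Fact padic_addA : associative padic_add.
Proof.
by move=> x y z; apply: padic_ext => k /=; rewrite modnDml modnDmr addnA.
Qed.

Fact padic_addC : commutative padic_add.
Proof. by move=> x y; apply: padic_ext => k /=; rewrite addnC. Qed.

Fact padic_add0 : left_id (padic_nat 0) padic_add.
Proof.
by move=> x; apply: padic_ext => k /=; rewrite mod0n add0n approx_mod.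
Qed.

Fact padic_addN : left_inverse (padic_nat 0) padic_opp padic_add.
Proof.
move=> x; apply: padic_ext => k /=; rewrite modnDml subnK ?modnn ?mod0n //.
exact: ltnW (approx_lt x k).
Qed.

HB.instance Definition _ :=
  GRing.isZmodule.Build Zp padic_addA padic_addC padic_add0 padic_addN.

Fact padic_mulA : associative padic_mul.
Proof.
by move=> x y z; apply: padic_ext => k /=; rewrite modnMml modnMmr mulnA.
Qed.

Fact padic_mulC : commutative padic_mul.
Proof. by move=> x y; apply: padic_ext => k /=; rewrite mulnC. Qed.

Fact padic_mul1 : left_id (padic_nat 1) padic_mul.
Proof.
by move=> x; apply: padic_ext => k /=; rewrite modnMml mul1n approx_mod.
Qed.

Fact padic_mulD : left_distributive padic_mul padic_add.
Proof.
by move=> x y z; apply: padic_ext => k /=; rewrite modnMml modnDm mulnDl.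
Qed.

Fact padic_1neq0 : padic_nat 1 != 0 :> Zp.
Proof.
apply/eqP => /(congr1 (fun x => approx x 1)) /=.
by rewrite expn1 mod0n modn_small.
Qed.

HB.instance Definition _ := GRing.Zmodule_isComNzRing.Build Zp
  padic_mulA padic_mulC padic_mul1 padic_mulD padic_1neq0.

Lemma approxD x y k : approx (x + y) k = ((approx x k + approx y k) %% p ^ k)%N.
Proof. by []. Qed.

Lemma approxM x y k : approx (x * y) k = ((approx x k * approx y k) %% p ^ k)%N.
Proof. by []. Qed.

Lemma approx_nat n k : approx (n%:R : Zp) k = (n %% p ^ k)%N.
Proof.
elim: n => [|n IHn]; first by rewrite mulr0n /= mod0n.
by rewrite mulrS approxD IHn modnDm add1n.
Qed.

(* The i-th digit a_i in the expansion x = \sum_i a_i p^i; see [digit_lt],    *)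
(* [approx_digits] and [digit_unique].                                        *)
Definition digit x (i : nat) : nat := (approx x i.+1 %/ p ^ i)%N.

Lemma digit_lt x i : (digit x i < p)%N.
Proof. by rewrite /digit ltn_divLR ?expp_gt0 // -expnS approx_lt. Qed.

Lemma approx_digits x k : approx x k = (\sum_(i < k) digit x i * p ^ i)%N.
Proof.
elim: k => [|k IHk]; first by rewrite big_ord0 approxP modn1.
by rewrite big_ord_recr /= -IHk (approxP x k) addnC -divn_eq.
Qed.

Lemma digit_unique x (e : nat -> nat) : (forall i, (e i < p)%N) ->
  (forall k, approx x k = (\sum_(i < k) e i * p ^ i)%N) -> digit x =1 e.
Proof.
move=> he hx i; rewrite /digit hx big_ord_recr /= -hx addnC.
by rewrite divnMDl ?expp_gt0 // divn_small ?addn0 ?approx_lt.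
Qed.

Definition resid x : nat := digit x 0.

Definition eqmodp (k : nat) x y := exists z, x - y = p%:R ^+ k * z.

Definition in_class (r : nat) x := exists z, x = r%:R + p%:R * z.

Definition weakly_suitable (r : nat) (f : Zp -> Zp) (k : nat) :=
  forall m n, in_class r m -> in_class r n ->
  eqmodp k m n -> eqmodp k (f m - (resid (f m))%:R) (f n - (resid (f n))%:R).

Definition suitable (r : nat) (f : Zp -> Zp) (k : nat) :=
  forall m n, in_class r m -> in_class r n ->
  (eqmodp k m n <-> eqmodp k (f m - (resid (f m))%:R) (f n - (resid (f n))%:R)).

End PadicRing.

(* Main.v *)
(* For m, n in r + p Z_p one has f(m) - f(n) = (m - n) q with q congruent to
   f'(r) mod p, and f(m) and f(n) have the same residue mod p. Hence a
   congruence of m and n mod p^k always carries over to the images. If f'(r) is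
   coprime to p, then so is q, and q can be cancelled mod p^k. If they have a
   common divisor g > 1, then m - n = p^(k-1) (p / g) is nonzero mod p^k but
   is killed by q. *)
Require Import Defs.
From HB Require Import structures.
From mathcomp Require Import all_boot all_order all_algebra.
From mathcomp Require Import boolp classical_sets.
From mathcomp Require Import ring.

Import GRing.Theory.
Local Open Scope classical_set_scope.
Local Open Scope ring_scope.

(** Induction on [f] gives Taylor's formula with an explicit multiple of [h] squared as remainder,
    without dividing by 2. *)
Lemma horner_taylor1 (R : comNzRingType) (f : {poly R}) (x h : R) :
  exists q, f.[x + h] = f.[x] + h * (f^`().[x] + h * q).
Proof.
elim/poly_ind: f => [|f c [q IHf]].
  by exists 0; rewrite deriv0 !horner0; ring.
(* The coefficient of [h] squared in the product of the expansion of [f] with [x + h]. *)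
exists (f^`().[x] + q * (x + h)).
rewrite derivD derivM derivX derivC addr0 mulr1 !hornerE IHf; ring.
Qed.

Section PadicCongruences.
Set Implicit Arguments.
Unset Strict Implicit.
Context {p : nat} {hp : (1 < p)%N}.
Local Notation Zp := (padic hp).
Implicit Types (x y z : Zp) (f : {poly Zp}) (k r : nat).

(** Once the approximation at level [k] vanishes, all later ones are divisible by [p ^ k]. Shifting
    the index by [k] and dividing gives a compatible sequence, which is the quotient. *)
Lemma approx_dvd x k : approx x k = 0%N -> exists z, x = p%:R ^+ k * z.
Proof.
move=> xk0.
have dvd_x j : (p ^ k %| approx x (j + k))%N.
  elim: j => [|j IHj]; first by rewrite xk0 dvdn0.
  have := IHj; rewrite approxP /dvdn modn_dvdm // expnD dvdn_mull //.
have zP j : (approx x (j + k) %/ p ^ k =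
    (approx x (j.+1 + k) %/ p ^ k) %% p ^ j)%N.
  apply/eqP; rewrite -(eqn_pmul2r (expp_gt0 hp k)) divnK //.
  by rewrite muln_modl divnK // -expnD -approxP.
exists (Padic hp zP); apply: padic_ext => j.
rewrite -natrX approxM approx_nat /= modnMml mulnC divnK //.
elim: k {xk0 dvd_x zP} => [|k IHk]; first by rewrite addn0 approx_mod.
by rewrite addnS IHk approxP modn_dvdm // expnD dvdn_mulr.
Qed.

Lemma eqmodpP k x y : eqmodp k x y <-> approx x k = approx y k.
Proof.
split=> [[z /(canRL (subrK y)) ->]|exy].
  by rewrite approxD approxM -natrX approx_nat modnn mul0n mod0n add0n approx_mod.
apply: approx_dvd; rewrite approxD /= modnDmr exy subnKC ?modnn //.
exact: ltnW (approx_lt y k).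
Qed.

Lemma residE x : resid x = approx x 1.
Proof. by rewrite /resid /digit divn1. Qed.

Lemma approx_resid x k : (0 < k)%N -> (approx x k %% p = resid x)%N.
Proof.
rewrite residE; case: k => // k _.
elim: k => [|k <-]; first by rewrite -[X in (_ %% X)%N]expn1 approx_mod.
by rewrite (approxP x k.+1) modn_dvdm // expnS dvdn_mulr.
Qed.

Lemma resid_lt x : (resid x < p)%N.
Proof. exact: digit_lt. Qed.

Lemma residD x y : resid (x + y) = ((resid x + resid y) %% p)%N.
Proof. by rewrite !residE approxD expn1. Qed.

Lemma residM x y : resid (x * y) = ((resid x * resid y) %% p)%N.
Proof. by rewrite !residE approxM expn1. Qed.

Lemma resid_nat n : resid (n%:R : Zp) = (n %% p)%N.
Proof. by rewrite residE approx_nat expn1. Qed.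

Lemma resid_pmul x : resid (p%:R * x) = 0%N.
Proof. by rewrite residM resid_nat modnn mul0n mod0n. Qed.

Lemma eq_residP x y : resid x = resid y <-> exists z, x = y + p%:R * z.
Proof.
split=> [|[z ->]]; last first.
  by rewrite residD resid_pmul addn0 modn_small ?resid_lt.
rewrite !residE => /eqmodpP[z exy]; exists z.
by move/(canRL (subrK y)): exy => ->; rewrite expr1 addrC.
Qed.

Lemma in_class_resid r x : in_class r x -> resid x = resid (r%:R : Zp).
Proof. by move/eq_residP. Qed.

(** Taylor expansion at [y] with increment [p%:R * z]: the secant slope is the derivative plus a
    multiple of [p]. *)
Lemma horner_secant f x y : resid x = resid y ->
  exists2 q, f.[x] - f.[y] = (x - y) * q & resid q = resid f^`().[y].
Proof.
move=> /eq_residP[z ->]; have [q ->] := horner_taylor1 _ f y (p%:R * z).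
exists (f^`().[y] + p%:R * z * q); first by rewrite ![_ + _ * _]addrC !addrK.
by rewrite -mulrA residD resid_pmul addn0 modn_small ?resid_lt.
Qed.

Lemma resid_horner f x y : resid x = resid y -> resid f.[x] = resid f.[y].
Proof.
move=> exy; have [q efxy _] := horner_secant f exy.
move/eq_residP: exy => [z exy]; apply/eq_residP; exists (z * q).
by rewrite -[LHS](subrK f.[y]) efxy exy addrC addrAC subrr add0r mulrA.
Qed.

(** The two subtracted residues agree, so they cancel and leave the secant. The same invariance of
    residues, applied to the derivative, replaces [y] by [r]. *)
Lemma poly_image_secant r f x y : in_class r x -> in_class r y ->
  exists2 q, (f.[x] - (resid f.[x])%:R) - (f.[y] - (resid f.[y])%:R)
             = (x - y) * q
           & resid q = resid f^`().[r%:R].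
Proof.
move=> /in_class_resid rx /in_class_resid ry.
have exy : resid x = resid y by rewrite rx ry.
have [q efxy rq] := horner_secant f exy.
exists q; last by rewrite rq; apply: resid_horner.
by rewrite (resid_horner f exy) -efxy opprB addrA subrK.
Qed.

Lemma weakly_suitable_poly r f k : weakly_suitable r (fun x => f.[x]) k.
Proof.
move=> x y rx ry [z exy]; have [q e _] := poly_image_secant f rx ry.
by exists (z * q); rewrite e exy mulrA.
Qed.

Lemma suitable_poly_le1 r f k : (k <= 1)%N -> suitable r (fun x => f.[x]) k.
Proof.
move=> k_le1 x y rx ry; split; first exact: (weakly_suitable_poly f rx ry).
(* Modulo 1 everything is congruent; modulo [p] all members of the class are. *)
move=> _; apply/eqmodpP; case: k k_le1 => [|[|//]] _.
  by rewrite !(approxP _ 0) expn0 !modn1.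
by rewrite -!residE (in_class_resid rx) (in_class_resid ry).
Qed.

(** An approximation of [q] at a positive level has the same remainder mod [p] as [q], so it is
    coprime to [p ^ k] and Gauss's lemma cancels it. *)
Lemma eqmodp_mul_coprime k x q : (0 < k)%N -> coprime p (resid q) ->
  eqmodp k (x * q) 0 -> eqmodp k x 0.
Proof.
have approx0 : approx (0 : Zp) k = 0%N by rewrite /= mod0n.
move=> k_gt0 cop_q /eqmodpP; rewrite approx0 approxM => /eqP xq0.
apply/eqmodpP; rewrite approx0 -approx_mod; apply/eqP.
rewrite -/(dvdn _ _) -(@Gauss_dvdl _ _ (approx q k)) //.
by rewrite coprimeXl // -coprime_modr approx_resid.
Qed.

Lemma suitable_poly r f k : (2 <= k)%N ->
  suitable r (fun x => f.[x]) k <-> coprime p (resid f^`().[r%:R]).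
Proof.
have eqmodp_sub x y : eqmodp k x y <-> eqmodp k (x - y) 0.
  by rewrite /eqmodp subr0.
move=> k_ge2; split=> [suit_f|cop_f x y rx ry]; last first.
  split; first exact: (weakly_suitable_poly f rx ry).
  have [q e rq] := poly_image_secant f rx ry.
  move=> /eqmodp_sub; rewrite e => xyq0; apply/eqmodp_sub.
  by apply: eqmodp_mul_coprime xyq0; rewrite ?rq // ltnW.
set D := resid _ in suit_f *.
have g_gt0 : (0 < gcdn p D)%N by rewrite gcdn_gt0 ltnW.
(* With g the gcd of [p] and [D], write p = u g and D = v g. *)
have [u /esym pE] := dvdnP (dvdn_gcdl p D).
have [v /esym DE] := dvdnP (dvdn_gcdr p D).
case: k k_ge2 suit_f {eqmodp_sub} => [|[|k]] // _ suit_f.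
(* The level is now [k.+2], and [x] differs from [r] by p^(k+1) (p/g). *)
pose x : Zp := r%:R + (p ^ k.+1 * u)%:R.
have rr : in_class r (r%:R : Zp) by exists 0; rewrite mulr0 addr0.
have rx : in_class r x.
  by exists (p ^ k * u)%:R; rewrite -natrM mulnA -expnS.
have [q e rq] := poly_image_secant f rx rr.
have [t qE] : exists t, q = D%:R + p%:R * t.
  by apply/eq_residP; rewrite rq resid_nat modn_small ?resid_lt.
have /(suit_f _ _ rx rr)[w] : eqmodp k.+2 (f.[x] - (resid f.[x])%:R)
    (f.[r%:R] - (resid f.[r%:R])%:R).
  (* From u D = p v and q = D + p t follows u q = p (v + u t), which supplies the missing factor
     [p]. *)
  exists (v%:R + u%:R * t); rewrite e qE /x addrAC subrr add0r.
  have uD : (u * D = p * v)%N by rewrite -[in RHS]pE mulnAC -mulnA DE.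
  have uDR : (u%:R * D%:R = p%:R * v%:R :> Zp) by rewrite -!natrM uD.
  by rewrite natrM natrX -mulrA mulrDr uDR [p%:R ^+ k.+2]exprSr; ring.
(* Suitability now forces [p] to divide u = p/g, hence g = 1. *)
rewrite /x addrAC subrr add0r => /(congr1 (fun z : Zp => approx z k.+2)).
rewrite -natrX approxM !approx_nat modnn mul0n mod0n => /eqP.
rewrite -/(dvdn _ _) expnSr dvdn_pmul2l ?expp_gt0 // => p_dvd_u.
have u_gt0 : (0 < u)%N.
  by move: (ltnW hp); rewrite -[in X in X -> _]pE muln_gt0 => /andP[].
have := dvdn_leq u_gt0 p_dvd_u; rewrite -[in X in X -> _]pE -[leqRHS]muln1.
by rewrite leq_pmul2l // => g_le1; rewrite /coprime eqn_leq g_le1 g_gt0.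
Qed.

(** The bounds are general because the sum is used from 0 for [f] and from 2 for the fixed part of
    [g]. *)
Lemma resid_deriv_sum (a : nat -> Zp) r m n :
  resid (\sum_(m <= i < n) a i *: 'X^i)^`().[r%:R] =
    ((\sum_(m <= i < n) resid (a i) * i * r ^ (i - 1)) %% p)%N.
Proof.
elim/big_rec2: _ => [|i y x _ IHx].
  by rewrite deriv0 horner0 (resid_nat 0).
rewrite derivD derivZ derivXn hornerD hornerZ hornerMn hornerXn residD IHx.
rewrite residM -natrX -mulrnA resid_nat modnMmr modnDm subn1.
by rewrite [(r ^ _ * _)%N]mulnC mulnA.
Qed.

End PadicCongruences.

Theorem theorem4p8 (p : nat) (hp : (1 < p)%N) (r : nat) (hr : (r < p)%N)
    (d : nat) (a : nat -> padic hp) (k : nat) :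
  let f : {poly padic hp} := \sum_(0 <= i < d.+1) a i *: 'X^i in
  let g (b : padic hp) : {poly padic hp} :=
    (a 0%N)%:P + b *: 'X + \sum_(2 <= i < d.+1) a i *: 'X^i in
  let s : nat := (\sum_(2 <= i < d.+1) resid (a i) * i * r ^ (i - 1))%N in
  [/\ weakly_suitable r (fun x => f.[x]) k,
      (k <= 1)%N -> suitable r (fun x => f.[x]) k,
      (2 <= k)%N ->
        (suitable r (fun x => f.[x]) k <->
         gcdn p (resid f^`().[r%:R]) = 1%N),
      resid f^`().[r%:R] =
        ((\sum_(1 <= i < d.+1) resid (a i) * i * r ^ (i - 1)) %% p)%N
    & (2 <= k)%N ->
        [set b : padic hp | suitable r (fun x => (g b).[x]) k] =
        [set ((c%:Z - s%:Z) %% p%:Z)%Z%:~R + p%:R * z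
          | c in [set c : nat | (c < p)%N /\ gcdn p c = 1%N]
          & z in [set: padic hp]]].
Proof.
move=> f g s; split.
- exact: weakly_suitable_poly.
- exact: suitable_poly_le1.
- by move=> /(suitable_poly r f) ->; split=> /eqP.
(* The term of index 0, with truncated exponent [0 - 1], vanishes through its factor 0. *)
- by rewrite resid_deriv_sum big_ltn // muln0 mul0n add0n.
- move=> k_ge2.
  have resid_g (b : padic hp) : resid (g b)^`().[r%:R] = ((resid b + s) %% p)%N.
    rewrite /g 2!derivD derivC derivZ derivX add0r hornerD residD resid_deriv_sum.
    by rewrite modnDmr hornerZ hornerC mulr1.
  apply/seteqP; split=> b /=.
    move=> /(suitable_poly r (g b) k_ge2); rewrite resid_g => cop_b.
    (* This c is the residue of the derivative, and c - s reduces to the residue of [b]. *)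
    exists ((resid b + s) %% p)%N; first by split; [rewrite ltn_mod ltnW | apply/eqP].
    have /eq_residP[z bE] : resid b = resid ((resid b)%:R : padic hp).
      by rewrite resid_nat modn_small ?resid_lt.
    exists z => //; rewrite [RHS]bE -modz_nat modzDml PoszD addrK modz_nat.
    by rewrite modn_small ?resid_lt.
  case=> c [c_lt cop_c] [z _ <-]; apply/(suitable_poly r _ k_ge2); rewrite resid_g.
  have p_neq0 : p%:Z != 0 by rewrite -lt0n ltnW.
  (* The integer remainder is nonnegative, hence a natural number n with n + s congruent to c; as c
     < p, the derivative has residue c. *)
  have := modz_ge0 (c%:Z - s%:Z) p_neq0.
  set t := modz _ _; have tE : (t + s%:Z = c%:Z %[mod p])%Z.
    by rewrite modzDml subrK.
  case: t tE => [n|//] tE _.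
  rewrite -pmulrn residD resid_pmul addn0 resid_nat modn_mod modnDml.
  by move: tE; rewrite -PoszD !modz_nat => -[->]; rewrite modn_small // /coprime cop_c.
Qed.
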